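(* Let $R, S$ be finite posets. Then $\# \mathcal{S}(P,R) = \# \mathcal{S}(P,S)$ holds for every finite poset $P$ if and only if $R$ and $S$ are isomorphic.
   Context: For posets $P, Q$, $\mathcal{S}(P,Q)$ is the set of strict order homomorphisms from $P$ to $Q$, i.e. maps $\xi : P \to Q$ with $x \leq y \Rightarrow \xi(x) \leq \xi(y)$ and $x < y \Rightarrow \xi(x) < \xi(y)$ for all $x,y \in P$. *)

(* Defs.v *)
From HB Require Import structures.
From mathcomp Require Import all_boot all_order.

Set Implicit Arguments.
Unset Strict Implicit.
Unset Printing Implicit Defensive.

Import Order.TTheory.
Local Open Scope order_scope.

Definition strict_homs (dP dQ : Order.disp_t)
    (P : finPOrderType dP) (Q : finPOrderType dQ) : {set {ffun P -> Q}} :=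
  [set xi : {ffun P -> Q} |
    [forall x : P, forall y : P,
       ((x <= y) ==> (xi x <= xi y)) && ((x < y) ==> (xi x < xi y))]].

Definition poset_isomorphic (dP dQ : Order.disp_t)
    (P : finPOrderType dP) (Q : finPOrderType dQ) : Prop :=
  exists2 f : P -> Q, bijective f & {mono f : x y / x <= y}.

(* Main.v *)
Require Import Defs.
From HB Require Import structures.
From mathcomp Require Import all_boot all_order.

(** The argument is Lovasz's: the numbers of homomorphisms into R determine the
    numbers of injective homomorphisms into R.  The source is allowed to be an
    arbitrary finite digraph (V, e) instead of a poset, because digraphs, unlike
    posets, are stable under identifying two vertices.

    Passing to digraphs costs nothing ([card_strict_maps_eq]): a map that sends
    edges to strict inequalities also sends the transitive closure of e to
    strict inequalities.  Either that closure is irreflexive, and the maps are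
    the strict homomorphisms from a poset, or e has a cycle, and there is no map.

    Injectivity is a finite list of conditions f x != f y.  One such condition
    is removed by deletion and contraction: the maps with f x != f y are all maps
    but those with f x = f y, and the latter are the maps from the digraph in
    which x and y are merged.  Induction on the list ([card_separating_maps_eq])
    shows that R and S receive equally many injective maps from each digraph.

    The identity of R is one of these, so there is an injective strictly monotone
    map from R to S, and likewise from S to R.  Such a map injects the order
    relation of R, as a finite set of pairs, into that of S.  As this holds both
    ways, the two relations have the same size, so each map is onto on pairs,
    which means that it reflects the order. *)

Set Implicit Arguments.
Unset Strict Implicit.
Unset Printing Implicit Defensive.

Import Order.TTheory.
Local Open Scope order_scope.

(** * Strictly monotone maps from a digraph *)

Definition is_strict_map (V : finType) (e : rel V) (d : Order.disp_t)
    (Q : finPOrderType d) (f : V -> Q) : bool :=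
  [forall x, forall y, e x y ==> (f x < f y)].

Lemma is_strict_mapP (V : finType) (e : rel V) (d : Order.disp_t)
    (Q : finPOrderType d) (f : V -> Q) :
  reflect (forall x y, e x y -> f x < f y) (is_strict_map e f).
Proof.
apply: (iffP forallP) => [ef x y exy | ef x].
  by have /forallP/(_ y)/implyP := ef x; apply.
by apply/forallP => y; apply/implyP/ef.
Qed.

Lemma strict_homsE (dP dQ : Order.disp_t)
    (P : finPOrderType dP) (Q : finPOrderType dQ) :
  strict_homs P Q = [set f : {ffun P -> Q} | is_strict_map <%O f].
Proof.
apply/setP => f; rewrite !inE; apply/forallP/is_strict_mapP => [hf x y xy | hf x].
  by have /forallP/(_ y)/andP[_ /implyP] := hf x; apply.
apply/forallP => y; apply/andP; split; apply/implyP; last exact: hf.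
by rewrite le_eqVlt => /predU1P[-> // | /hf/ltW].
Qed.

Definition trans_closure (V : finType) (e : rel V) : rel V :=
  fun x y => [exists z, e x z && connect e z y].

Lemma sub_trans_closure (V : finType) (e : rel V) :
  subrel e (trans_closure e).
Proof. by move=> x y exy; apply/existsP; exists y; rewrite exy connect0. Qed.

Lemma trans_closure_trans (V : finType) (e : rel V) :
  transitive (trans_closure e).
Proof.
move=> y x z /existsP[u /andP[exu uy]] /existsP[v /andP[eyv vz]].
apply/existsP; exists u; rewrite exu.
exact: connect_trans uy (connect_trans (connect1 eyv) vz).
Qed.

Lemma strict_map_trans_closure (V : finType) (e : rel V) (d : Order.disp_t)
    (Q : finPOrderType d) (f : V -> Q) :
  is_strict_map (trans_closure e) f = is_strict_map e f.
Proof.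
apply/is_strict_mapP/is_strict_mapP => ef x y; first by move/sub_trans_closure/ef.
case/existsP=> z /andP[/ef xz /connectP[p]].
elim: p z xz => [|w p IHp] z xz /=; first by move=> _ ->.
by case/andP=> /ef zw; apply: IHp; apply: lt_trans zw.
Qed.

(** An alias of V that carries the proof that e is acyclic, so that the order
    generated by e can be attached to it. *)
Definition acyclic_poset (V : finType) (e : rel V)
  (irr : irreflexive (trans_closure e)) : Type := V.

Section AcyclicPoset.
Variables (V : finType) (e : rel V) (irr : irreflexive (trans_closure e)).

HB.instance Definition _ := Finite.on (acyclic_poset irr).
HB.instance Definition _ :=
  Order.Lt_isPOrder.Build (Order.Disp tt tt) (acyclic_poset irr) irr
    (@trans_closure_trans V e).

End AcyclicPoset.

(** An acyclic digraph has the same strictly monotone maps as the poset that it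
    generates; on a cycle such a map would give a point below itself. *)
Lemma card_strict_maps_eq (dR dS : Order.disp_t)
    (R : finPOrderType dR) (S : finPOrderType dS)
    (RS : forall (d : Order.disp_t) (P : finPOrderType d),
       #|strict_homs P R| = #|strict_homs P S|) (V : finType) (e : rel V) :
  #|[set f : {ffun V -> R} | is_strict_map e f]| =
  #|[set f : {ffun V -> S} | is_strict_map e f]|.
Proof.
have [/existsP[x xx] | /existsPn irr] := boolP [exists x, trans_closure e x x].
  have no_map d (Q : finPOrderType d) :
      [set f : {ffun V -> Q} | is_strict_map e f] = set0.
    apply/setP => f; rewrite !inE -strict_map_trans_closure.
    by apply/is_strict_mapP => /(_ _ _ xx); rewrite ltxx.
  by rewrite !no_map !cards0.
have {}irr : irreflexive (trans_closure e) by move=> x; apply/negbTE/irr.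
(* Without eta for records, the finite type copied onto the alias is convertible
   to V only once V is an explicit record. *)
case: V => T cT in e irr *.
have homsE d (Q : finPOrderType d) :
    #|[set f : {ffun Finite.Pack cT -> Q} | is_strict_map e f]| =
    #|strict_homs (acyclic_poset irr) Q|.
  rewrite strict_homsE; apply: eq_card => f.
  by rewrite !inE -strict_map_trans_closure.
by rewrite !homsE; apply: RS.
Qed.

(** * Deletion and contraction *)

(** Precomposition with a retraction p identifies the maps from the retract
    with the maps from V that are constant along the fibres of p. *)
Lemma card_factoring (V W : finType) (Q : finType) (p : V -> W) (s : W -> V)
    (sK : cancel s p) (A : pred {ffun V -> Q}) :
  #|[set g : {ffun W -> Q} | A [ffun x => g (p x)]]| =
  #|[set f : {ffun V -> Q} | A f & [forall x, f (s (p x)) == f x]]|.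
Proof.
pose pre (g : {ffun W -> Q}) := [ffun x => g (p x)].
have pre_inj : injective pre.
  by move=> g h /ffunP gh; apply/ffunP=> w; have := gh (s w); rewrite !ffunE sK.
rewrite -(card_imset _ pre_inj); apply: eq_card => f; rewrite !inE.
apply/imsetP/andP => [[g] | [Af /forallP fsp]].
  rewrite inE => Ag ->; split=> //.
  by apply/forallP => x; rewrite !ffunE sK.
have fE : f = pre [ffun w => f (s w)].
  by apply/ffunP=> x; rewrite !ffunE (eqP (fsp x)).
by exists [ffun w => f (s w)]; rewrite // inE -[[ffun _ => _]]/(pre _) -fE.
Qed.

Definition separates (V : finType) (Q : eqType) (D : seq (V * V)) (f : V -> Q) :=
  all (fun xy => f xy.1 != f xy.2) D.

Definition push_rel (V W : finType) (p : V -> W) (e : rel V) : rel W :=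
  fun a b => [exists x, exists y, [&& e x y, p x == a & p y == b]].

Lemma strict_map_comp (V W : finType) (p : V -> W) (e : rel V)
    (d : Order.disp_t) (Q : finPOrderType d) (g : W -> Q) :
  is_strict_map (push_rel p e) g = is_strict_map e (g \o p).
Proof.
apply/is_strict_mapP/is_strict_mapP => [eg x y exy | eg a b].
  by apply: eg; apply/existsP; exists x; apply/existsP; exists y; rewrite exy !eqxx.
by case/existsP=> x /existsP[y /and3P[exy /eqP<- /eqP<-]]; apply: eg.
Qed.

Lemma eq_is_strict_map (V : finType) (e : rel V) (d : Order.disp_t)
    (Q : finPOrderType d) (f g : V -> Q) :
  f =1 g -> is_strict_map e f = is_strict_map e g.
Proof. by move=> fg; apply: eq_forallb => x; apply: eq_forallb => y; rewrite !fg. Qed.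

Definition separating_maps (V : finType) (e : rel V) (D : seq (V * V))
    (d : Order.disp_t) (Q : finPOrderType d) : {set {ffun V -> Q}} :=
  [set f : {ffun V -> Q} | is_strict_map e f && separates D f].

Section Contraction.
Variables (V : finType) (x y : V) (xNy : x != y).

Definition merged : finType := {z : V | z != y}.

Definition merge (z : V) : merged := insubd (Sub x xNy : merged) z.

Lemma val_mergeK : cancel val merge.
Proof. by move=> z; apply: valKd. Qed.

Lemma val_merge z : val (merge z) = if z == y then x else z.
Proof. by rewrite val_insubd; case: eqP. Qed.

(** A map with f x = f y is constant along the fibres of [merge], so it factors
    through the merged vertex set; both kinds of constraint on f are carried
    along by pushing them forward. *)
Lemma card_contraction (e : rel V) (D : seq (V * V)) (d : Order.disp_t)
    (Q : finPOrderType d) :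
  #|separating_maps (push_rel merge e)
      [seq (merge uv.1, merge uv.2) | uv <- D] Q| =
  #|[set f in separating_maps e D Q | f x == f y]|.
Proof.
pose A (f : {ffun V -> Q}) := is_strict_map e f && separates D f.
transitivity #|[set g : {ffun merged -> Q} | A [ffun z => g (merge z)]]|.
  apply: eq_card => g; rewrite !inE /A strict_map_comp; congr (_ && _).
    by apply: eq_is_strict_map => z; rewrite ffunE.
  by rewrite /separates all_map; apply: eq_all => uv /=; rewrite !ffunE.
rewrite (card_factoring val_mergeK); apply: eq_card => f; rewrite !inE.
congr (_ && _); apply/forallP/eqP => [/(_ y) | fxy z].
  by rewrite val_merge eqxx => /eqP.
by rewrite val_merge; case: (eqVneq z y) => [->|_]; rewrite ?fxy.
Qed.

End Contraction.

(** In the deletion-contraction formula two of the three counts, those with one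
    condition fewer, agree for R and S, so the third one does.  The induction is
    on the length of D with V, e and D arbitrary, since a contraction changes
    all three. *)
Lemma card_separating_maps_eq (dR dS : Order.disp_t)
    (R : finPOrderType dR) (S : finPOrderType dS)
    (RS : forall (d : Order.disp_t) (P : finPOrderType d),
       #|strict_homs P R| = #|strict_homs P S|)
    (V : finType) (e : rel V) (D : seq (V * V)) :
  #|separating_maps e D R| = #|separating_maps e D S|.
Proof.
have [n] := ubnP (size D); elim: n => // n IHn in V e D *.
case: D => [_ | [x y] D /= ltDn].
  rewrite /separating_maps; have := card_strict_maps_eq RS e.
  by under eq_finset do rewrite -[is_strict_map _ _]andbT;
     under [in RHS]eq_finset do rewrite -[is_strict_map _ _]andbT.
have [<- | xNy] := eqVneq x y.
  have none d (Q : finPOrderType d) :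
      separating_maps e ((x, x) :: D) Q = set0.
    by apply/setP => f; rewrite !inE /= eqxx andbF.
  by rewrite !none !cards0.
have delE d (Q : finPOrderType d) :
    #|separating_maps e D Q| =
    (#|[set f in separating_maps e D Q | f x == f y]| +
     #|separating_maps e ((x, y) :: D) Q|)%N.
  rewrite -(cardsID [set f : {ffun V -> Q} | f x == f y]); congr (_ + _)%N.
    by apply: eq_card => f; rewrite !inE.
  by apply: eq_card => f; rewrite !inE /= andbCA.
have := IHn V e D ltDn; rewrite !delE -!(card_contraction xNy).
by rewrite IHn ?size_map // => /addnI.
Qed.

(** * Injective strictly monotone maps *)

(** Separating all pairs of distinct points is injectivity, and the identity of
    R makes the count for the source R positive. *)
Lemma exists_injective_strict_map (dR dS : Order.disp_t)
    (R : finPOrderType dR) (S : finPOrderType dS)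
    (RS : forall (d : Order.disp_t) (P : finPOrderType d),
       #|strict_homs P R| = #|strict_homs P S|) :
  exists2 f : R -> S, injective f & {homo f : x y / x < y}.
Proof.
pose D := [seq xy <- enum {: R * R} | xy.1 != xy.2].
have : (0 < #|separating_maps <%O D R|)%N.
  apply/card_gt0P; exists [ffun x => x]; rewrite inE; apply/andP; split.
    by apply/is_strict_mapP => x y; rewrite !ffunE.
  by apply/allP => xy; rewrite mem_filter !ffunE => /andP[].
rewrite (card_separating_maps_eq RS) => /card_gt0P[f].
rewrite inE => /andP[/is_strict_mapP mf /allP sepf]; exists f => // x y fxy.
apply/eqP/contraT => xNy; have := sepf (x, y).
by rewrite mem_filter mem_enum /= xNy fxy eqxx => /(_ isT).
Qed.

Definition le_pairs (d : Order.disp_t) (Q : finPOrderType d) : {set Q * Q} :=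
  [set xy | xy.1 <= xy.2].

Definition map_pair (A B : Type) (f : A -> B) (xy : A * A) := (f xy.1, f xy.2).

Lemma map_pair_inj (A B : Type) (f : A -> B) :
  injective f -> injective (map_pair f).
Proof. by move=> f_inj [x y] [z t] [/f_inj-> /f_inj->]. Qed.

Lemma le_pairs_sub (dR dS : Order.disp_t)
    (R : finPOrderType dR) (S : finPOrderType dS) (f : R -> S) :
  {homo f : x y / x < y} -> map_pair f @: le_pairs R \subset le_pairs S.
Proof.
move=> mf; apply/subsetP => _ /imsetP[[x y] xy ->]; move: xy; rewrite !inE /=.
exact: ltW_homo.
Qed.

(** Counting comparable pairs: f and g bound the number of pairs of each poset by
    that of the other, so every pair of S comes from a pair of R under f. *)
Lemma iso_of_injective_strict_maps (dR dS : Order.disp_t)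
    (R : finPOrderType dR) (S : finPOrderType dS) (f : R -> S) (g : S -> R) :
  injective f -> {homo f : x y / x < y} ->
  injective g -> {homo g : x y / x < y} -> poset_isomorphic R S.
Proof.
move=> f_inj mf g_inj mg; exists f.
  by apply: inj_card_bij => //; apply: leq_card g_inj.
have f_onto : map_pair f @: le_pairs R = le_pairs S.
  apply/eqP; rewrite eqEcard le_pairs_sub // card_imset; last exact: map_pair_inj.
  rewrite -(card_imset _ (map_pair_inj g_inj)).
  exact/subset_leq_card/le_pairs_sub.
move=> x y.
have := mem_imset (le_pairs R) (x, y) (map_pair_inj f_inj).
by rewrite f_onto !inE.
Qed.

(** * Isomorphic posets *)

Lemma poset_isomorphic_sym (dR dS : Order.disp_t)
    (R : finPOrderType dR) (S : finPOrderType dS) :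
  poset_isomorphic R S -> poset_isomorphic S R.
Proof.
case=> f [g fK gK] mf; exists g; first by exists f.
by move=> x y; rewrite -mf !gK.
Qed.

Lemma leq_card_strict_homs (dR dS dP : Order.disp_t)
    (R : finPOrderType dR) (S : finPOrderType dS) (P : finPOrderType dP) :
  poset_isomorphic R S -> (#|strict_homs P R| <= #|strict_homs P S|)%N.
Proof.
case=> f /bij_inj f_inj mf.
pose post (xi : {ffun P -> R}) := [ffun x => f (xi x)].
have post_inj : injective post.
  by move=> xi xj /ffunP eqx; apply/ffunP => x; have := eqx x; rewrite !ffunE => /f_inj.
rewrite -(card_imset _ post_inj) !strict_homsE.
apply/subset_leq_card/subsetP => _ /imsetP[xi + ->].
rewrite !inE => /is_strict_mapP mxi; apply/is_strict_mapP => x y /mxi.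
by rewrite !ffunE (leW_mono mf).
Qed.

Theorem corollary3 (dR dS : Order.disp_t)
    (R : finPOrderType dR) (S : finPOrderType dS) :
  (forall (dP : Order.disp_t) (P : finPOrderType dP),
     #|strict_homs P R| = #|strict_homs P S|) <->
  poset_isomorphic R S.
Proof.
split=> [RS | isoRS dP P].
  have [f f_inj mf] := exists_injective_strict_map RS.
  have SR d (P : finPOrderType d) : #|strict_homs P S| = #|strict_homs P R|.
    by rewrite RS.
  have [g g_inj mg] := exists_injective_strict_map SR.
  exact: iso_of_injective_strict_maps f_inj mf g_inj mg.
have isoSR := poset_isomorphic_sym isoRS.
by apply/eqP; rewrite eqn_leq !leq_card_strict_homs.
Qed.
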